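(* Let $0<q<1$, let $\{\omega_n(z;q)\}_{n\in\mathbb N_0}$ be an even $q$-Lidstone polynomial sequence of type I, let $F_q$ be its even $q$-Lidstone-type I matrix, $G_q=F_q^{-1}$, and let $\bar\Pi_G=[\bar\pi_{ij}]_{i,j\in\mathbb N_0}$ be the production matrix of $G_q$. Then $$\omega_0(z;q)=\frac{1}{\xi_0},\qquad \omega_{n+1}(z;q)= \frac{1}{\bar{\pi}_{n(n+1)}}\Big[z^{2}\omega_{n}(z;q)-\sum_{k=0}^{n} \bar{\pi}_{nk}\, \omega_k(z;q)\Big]\quad (n\in \mathbb{N}_0).$$
   Context: Fix $0<q<1$. Put $[m]_q=\frac{1-q^m}{1-q}$, $[m]_q!=\prod_{j=1}^m[j]_q$, $[0]_q!=1$, and ${n \brack k}_q=\frac{[n]_q!}{[k]_q!\,[n-k]_q!}$ for $0\le k\le n$. $\mathbb N=\{1,2,\dots\}$, $\mathbb N_0=\mathbb N\cup\{0\}$. The Jackson $q$-derivative is $D_qf(z)=\frac{f(qz)-f(z)}{(q-1)z}$ for $z\ne0$ and $D_qf(0)=f'(0)$, so $D_qz^m=[m]_qz^{m-1}$. An even $q$-Lidstone polynomial sequence of type I (class $q$ELS-I) is a sequence $\{\omega_n(z;q)\}_{n\in\mathbb N_0}$ of polynomials in $z$ with real coefficients such that $D_q^2\omega_n(z;q)=[2n]_q[2n-1]_q\,\omega_{n-1}(z;q)$ for $n\in\mathbb N$, $D_q\omega_n(0;q)=0$ for $n\in\mathbb N_0$, and $\omega_0(z;q)=\gamma_0$ with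 $\gamma_0\in\mathbb R\setminus\{0\}$. Its associated numerical sequence is $\gamma_{2n}:=\omega_n(0;q)$, and $\omega_n(z;q)=\sum_{k=0}^n{2n \brack 2k}_q\gamma_{2(n-k)}z^{2k}$. The sequence $(\xi_{2n})_{n\ge0}$ is the unique real sequence with $\sum_{j=0}^n\frac{\gamma_{2j}\,\xi_{2(n-j)}}{[2j]_q!\,[2(n-j)]_q!}=\delta_{n0}$ for all $n\in\mathbb N_0$. The matrix of $\{\omega_n\}_n$ is the infinite lower triangular matrix $F_q=[f_{ij}]_{i,j\in\mathbb N_0}$ with $f_{ij}={2i \brack 2j}_q\gamma_{2(i-j)}$ for $i\ge j$ and $0$ otherwise. Its inverse $G_q=[g_{ij}]$ is lower triangular with $g_{ij}={2i \brack 2j}_q\xi_{2(i-j)}$ for $i\ge j$. The production matrix of a nonsingular infinite lower triangular matrix $M$ is $\Pi_M=M^{-1}\overline M$, where $\overline M$ is $M$ with its first row removed; thus for $M=G_q$ one has $\bar\pi_{ij}=\sum_{n=0}^i f_{in}\,g_{(n+1)j}$. *)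

(* Defs.v *)
From HB Require Import structures.
From mathcomp Require Import all_boot all_order all_algebra.
From mathcomp Require Import reals topology normedtype derive.

Set Implicit Arguments.
Unset Strict Implicit.
Unset Printing Implicit Defensive.

Import Order.TTheory GRing.Theory Num.Theory.
Import numFieldNormedType.Exports.

Local Open Scope ring_scope.

Section QCalculus.
Context {R : realType}.
Implicit Types (q z : R) (f : R -> R).

Definition qnum q (m : nat) : R := (1 - q ^+ m) / (1 - q).

Definition qfact q (m : nat) : R := \prod_(1 <= j < m.+1) qnum q j.

(* Only meaningful (and only used below) for k <= n. *)
Definition qbinom q (n k : nat) : R :=
  qfact q n / (qfact q k * qfact q (n - k)).

(* Jackson q-derivative. *)
Definition Dq q f : R -> R := fun z =>
  if z == 0 then derive1 f 0 else (f (q * z) - f z) / ((q - 1) * z).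

End QCalculus.

(* Infinite matrices indexed by nat * nat. *)
Section InfiniteMatrices.
Context {R : realType}.
Implicit Types A B M P : nat -> nat -> R.

Definition lower_triangular A := forall i j, (i < j)%N -> A i j = 0.

(* Product of a lower triangular A with an arbitrary B: the terms of index
   k > i of the infinite sum vanish. *)
Definition lmul A B : nat -> nat -> R :=
  fun i j => \sum_(k < i.+1) A i k * B k j.

Definition imx1 : nat -> nat -> R := fun i j => (i == j)%:R.

Definition is_inverse A B :=
  [/\ lower_triangular A, lower_triangular B,
      forall i j, lmul A B i j = imx1 i j
    & forall i j, lmul B A i j = imx1 i j].

Definition drop_first_row M : nat -> nat -> R := fun i j => M i.+1 j.

(* P = M^-1 * (M without its first row). *)
Definition is_production_matrix M P :=
  exists2 N, is_inverse M N
           & forall i j, P i j = lmul N (drop_first_row M) i j.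

End InfiniteMatrices.

Section EvenLidstone.
Context {R : realType}.
Implicit Types (q : R) (omega : nat -> {poly R}).

(* The class qELS-I. *)
Definition is_qELS1 q omega :=
  [/\ forall n, (0 < n)%N -> forall z : R,
        Dq q (Dq q (fun x => (omega n).[x])) z =
          qnum q (2 * n) * qnum q (2 * n - 1) * (omega n.-1).[z],
      forall n, Dq q (fun x => (omega n).[x]) 0 = 0
    & exists2 g0 : R, g0 != 0 & omega 0%N = g0%:P].

(* The numerical sequences carry only even indices in the mathematics:
   [gammaE omega n] is gamma_{2n}, and below [xi n] is xi_{2n}. *)
Definition gammaE omega (n : nat) : R := (omega n).[0].

Definition is_xi_seq q omega (xi : nat -> R) :=
  forall n, \sum_(j < n.+1)
      gammaE omega j * xi (n - j)%N
        / (qfact q (2 * j) * qfact q (2 * (n - j))) = (n == 0%N)%:R.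

Definition lidstone_mx q omega : nat -> nat -> R := fun i j =>
  if (j <= i)%N then qbinom q (2 * i) (2 * j) * gammaE omega (i - j) else 0.

End EvenLidstone.

(* Main.v *)
(** Comparing coefficients in the defining q-difference equation shows that
    [omega_n] is the [n]-th row of F applied to the even monomials [z^(2k)];
    inverting, [z^(2k)] is the [k]-th row of G applied to the [omega_j].  So
    multiplication by [z^2], a shift on the even monomials, has in the basis
    [omega] the matrix F times (G without its first row), the production matrix
    of G: [z^2 omega_n = \sum_(j <= n+1) P n j omega_j].  Solve for
    [omega_(n+1)]. *)
Require Import Defs.
From mathcomp Require Import all_boot all_order all_algebra.
From mathcomp Require Import ring boolp.
From mathcomp Require Import reals topology normedtype derive.

Set Implicit Arguments.
Unset Strict Implicit.
Unset Printing Implicit Defensive.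

Import Order.TTheory GRing.Theory Num.Theory.
Local Open Scope ring_scope.

(** The naturals below [size (p - r)] are distinct in characteristic zero and are all roots of the
    difference: more roots than a nonzero polynomial of that size can have. *)
Lemma poly_horner_inj (R : numDomainType) (p r : {poly R}) :
  (forall x, p.[x] = r.[x]) -> p = r.
Proof.
move=> pr; apply/eqP; rewrite -subr_eq0; apply/eqP.
apply: (@roots_geq_poly_eq0 _ _ [seq i%:R | i <- iota 0 (size (p - r))]).
- by apply/allP => x _; rewrite /root hornerD hornerN pr subrr.
- by rewrite map_inj_uniq ?iota_uniq //; exact: mulrIn (oner_neq0 R).
- by rewrite size_map size_iota.
Qed.

Section QDerivative.
Context {R : realType}.
Implicit Types (q z : R) (p : {poly R}).

Lemma qnum_neq0 q m : 0 < q -> q < 1 -> (0 < m)%N -> qnum q m != 0.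
Proof.
move=> q0 q1 m0; rewrite /qnum mulf_neq0 ?invr_eq0 ?subr_eq0 //.
  by rewrite eq_sym lt_eqF // exprn_ilt1 ?ltW // -lt0n.
by rewrite eq_sym lt_eqF.
Qed.

Lemma qfact0 q : qfact q 0 = 1.
Proof. by rewrite /qfact big_geq. Qed.

Lemma qfactS q m : qfact q m.+1 = qfact q m * qnum q m.+1.
Proof. by rewrite /qfact big_nat_recr. Qed.

Lemma qfact_neq0 q m : 0 < q -> q < 1 -> qfact q m != 0.
Proof.
move=> q0 q1; elim: m => [|m IHm]; first by rewrite qfact0 oner_neq0.
by rewrite qfactS mulf_neq0 // qnum_neq0.
Qed.

Lemma qbinom0 q n : 0 < q -> q < 1 -> qbinom q n 0 = 1.
Proof. by move=> q0 q1; rewrite /qbinom subn0 qfact0 mul1r divff ?qfact_neq0. Qed.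

(** The absorption identity for Gaussian binomials, in division-free form. *)
Lemma qbinomSS q n k : 0 < q -> q < 1 ->
  qnum q k.+1 * qbinom q n.+1 k.+1 = qnum q n.+1 * qbinom q n k.
Proof.
move=> q0 q1; rewrite /qbinom subSS !qfactS.
by field; rewrite !qfact_neq0 ?qnum_neq0.
Qed.

Definition qderiv q p : {poly R} := \poly_(i < size p) (qnum q i.+1 * p`_i.+1).

Lemma coef_qderiv q p i : (qderiv q p)`_i = qnum q i.+1 * p`_i.+1.
Proof.
rewrite coef_poly; case: ltnP => // sp.
by rewrite [p`_i.+1]nth_default ?mulr0 // ltnW.
Qed.

Lemma Dq_horner q p : q < 1 -> Dq q (horner p) =1 horner (qderiv q p).
Proof.
move=> q1 z; rewrite /Dq; have q1' : 1 - q != 0 by rewrite subr_eq0 gt_eqF.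
have [->|z0] := eqVneq z 0.
  rewrite -derivE !horner_coef0 coef_deriv coef_qderiv /qnum expr1.
  by rewrite divff // mul1r.
have qz0 : (q - 1) * z != 0 by rewrite mulf_neq0 // -opprB oppr_eq0.
apply: (mulIf qz0); rewrite divfK // horner_poly.
(* One extra, zero term is added so that, once the constant terms cancel, [size p] terms remain, as
   in [qderiv]. *)
rewrite !(horner_coef_wide _ (leqnSn (size p))) -sumrB big_ord_recl.
rewrite !expr0 subrr add0r mulr_suml; apply: eq_bigr => i _.
by rewrite lift0 /qnum exprMn [z ^+ i.+1]exprS; field.
Qed.

End QDerivative.

Section LowerTriangular.
Context {R : realType}.
Implicit Types (A B C : nat -> nat -> R).

(** A general module [V] covers both sequences of polynomials and columns of scalars. *)
Definition lact (V : lmodType R) A (v : nat -> V) (i : nat) : V :=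
  \sum_(k < i.+1) A i k *: v k.

Lemma lact_widen (V : lmodType R) A (v : nat -> V) i m :
  lower_triangular A -> (i < m)%N -> lact A v i = \sum_(k < m) A i k *: v k.
Proof.
move=> lA im; rewrite /lact (big_ord_widen _ (fun k => A i k *: v k) im).
rewrite big_mkcond; apply: eq_bigr => k _.
by case: ltnP => // ik; rewrite lA // scale0r.
Qed.

Lemma lactM (V : lmodType R) A B (v : nat -> V) i : lower_triangular B ->
  lact (lmul A B) v i = lact A (lact B v) i.
Proof.
move=> lB; rewrite /lact /lmul.
under eq_bigr do rewrite scaler_suml.
rewrite exchange_big; apply: eq_bigr => k _.
rewrite -/(lact B v k) (lact_widen v lB (ltn_ord k)) scaler_sumr.
by apply: eq_bigr => j _; rewrite scalerA.
Qed.

Lemma lact1 (V : lmodType R) (v : nat -> V) i : lact imx1 v i = v i.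
Proof.
rewrite /lact big_ord_recr big1 /= ?add0r /imx1 ?eqxx ?scale1r // => k _.
by rewrite gtn_eqF // scale0r.
Qed.

Lemma eq_lact (V : lmodType R) A B (v w : nat -> V) i :
  A i =1 B i -> v =1 w -> lact A v i = lact B w i.
Proof. by move=> AB vw; apply: eq_bigr => k _; rewrite AB vw. Qed.

(** [A = (CB)A = C(BA) = C], read on column [j] of [A], viewed as a sequence in the module [R^o]. *)
Lemma is_inverse_uniq A B C : is_inverse A B -> is_inverse B C -> A =2 C.
Proof.
move=> [lA lB AB BA] [_ lC BC CB] i j.
pose a k : R^o := A k j.
rewrite -[LHS](lact1 a i).
rewrite -(eq_lact (v := a) (CB i) (frefl a)) // lactM //.
rewrite (eq_lact (w := imx1^~ j : nat -> R^o) (frefl (C i))); last first.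
  by move=> k; exact: BA.
have [ij|ji] := ltnP i j.
  by rewrite lC // /lact big1 // => k _; rewrite /imx1 ltn_eqF ?scaler0 //
     (leq_trans (ltn_ord k)).
rewrite /lact (bigD1 (Ordinal (ji : (j < i.+1)%N))) //= big1 => [|k kj].
  by rewrite /imx1 eqxx addr0 [LHS]mulr1.
by rewrite /imx1 -(inj_eq val_inj) /= in kj *; rewrite (negPf kj) scaler0.
Qed.

Lemma is_inverse_diag A B i : is_inverse A B -> A i i * B i i = 1.
Proof.
case=> lA lB AB _; have := AB i i; rewrite /lmul /imx1 eqxx big_ord_recr /=.
by rewrite big1 ?add0r // => k _; rewrite lB ?mulr0.
Qed.

(** Row [k.+1] of [B] stops at column [k.+1], so only [k = n] reaches column [n.+1]. *)
Lemma lmul_drop_first_row_diag A B n : lower_triangular B ->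
  lmul A (drop_first_row B) n n.+1 = A n n * B n.+1 n.+1.
Proof.
move=> lB; rewrite /lmul big_ord_recr /= big1 ?add0r // => k _.
by rewrite /drop_first_row lB ?mulr0 // ltnS.
Qed.

Lemma lact_drop_first_row (V : lmodType R) A B (v : nat -> V) n :
    lower_triangular B ->
  lact A (fun k => lact B v k.+1) n =
  \sum_(j < n.+2) lmul A (drop_first_row B) n j *: v j.
Proof.
move=> lB; rewrite /lmul.
under [RHS]eq_bigr do rewrite scaler_suml.
rewrite exchange_big; apply: eq_bigr => k _ /=.
have kn : (k.+1 < n.+2)%N by rewrite ltnS.
rewrite (lact_widen v lB kn) scaler_sumr.
by apply: eq_bigr => j _; rewrite scalerA.
Qed.

End LowerTriangular.

Section EvenLidstone.
Context {R : realType} (q : R) (omega : nat -> {poly R}).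
Hypotheses (q0 : 0 < q) (q1 : q < 1) (homega : is_qELS1 q omega).

Lemma coef_omegaSS n m :
  qnum q m.+1 * qnum q m.+2 * (omega n.+1)`_m.+2 =
  qnum q (2 * n).+1 * qnum q (2 * n).+2 * (omega n)`_m.
Proof.
have [+ _ _] := homega => /(_ n.+1 isT) D2.
have /(congr1 (fun p : {poly R} => p`_m)) :
    qderiv q (qderiv q (omega n.+1)) =
    (qnum q (2 * n.+1) * qnum q (2 * n.+1 - 1)) *: omega n.
  apply: poly_horner_inj => z; rewrite hornerZ -D2 -Dq_horner //.
  (* The inner [Dq] is the argument of the outer one, so it must be replaced as a function, not just
     at [z]. *)
  by rewrite (funext (Dq_horner (omega n.+1) q1)).
rewrite !coef_qderiv coefZ mulrA mulnS add2n subn1 => ->.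
by rewrite [X in X * _]mulrC.
Qed.

Lemma coef_omega1 n : (omega n)`_1 = 0.
Proof.
have [_ /(_ n) + _] := homega.
by rewrite Dq_horner // horner_coef0 coef_qderiv /qnum expr1 divff ?mul1r //
  subr_eq0 gt_eqF.
Qed.

(** [coef_omegaSS] lowers the degree by two and the index by one; the descent ends at the
    coefficient of [z] or at the constant [omega 0]. *)
Lemma coef_omega_odd n k : (omega n)`_(2 * k).+1 = 0.
Proof.
elim: k n => [n|k IHk [|n]]; first exact: coef_omega1.
  by have [_ _ [g _ ->]] := homega; rewrite coefC.
have c0 : qnum q (2 * k).+2 * qnum q (2 * k).+3 != 0.
  by rewrite mulf_neq0 ?qnum_neq0.
by apply: (mulfI c0); rewrite mulnS coef_omegaSS IHk !mulr0.
Qed.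

(** The same descent now ends at the constant coefficient, which is [gammaE], or at [omega 0]; two
    absorptions show that the matrix entries obey the same recurrence. *)
Lemma coef_omega_even n k : (omega n)`_(2 * k) = lidstone_mx q omega n k.
Proof.
elim: k n => [n|k IHk [|n]].
- by rewrite /lidstone_mx /= muln0 qbinom0 // mul1r subn0 /gammaE horner_coef0.
- by have [_ _ [g _ ->]] := homega; rewrite coefC mulnS.
have c0 : qnum q (2 * k).+1 * qnum q (2 * k).+2 != 0.
  by rewrite mulf_neq0 ?qnum_neq0.
apply: (mulfI c0); rewrite [(2 * k.+1)%N]mulnS [in LHS]coef_omegaSS IHk.
rewrite /lidstone_mx ltnS subSS; case: leqP => [_|]; last by rewrite !mulr0.
rewrite !mulnS !add2n [RHS]mulrA -[X in _ = X * _]mulrA qbinomSS //.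
rewrite [X in _ = X * _]mulrCA qbinomSS //; ring.
Qed.

Lemma omegaE n :
  omega n = lact (lidstone_mx q omega) (fun k => 'X^(2 * k)) n.
Proof.
apply/polyP => i; rewrite coef_sum.
under eq_bigr do rewrite coefZ coefXn.
have -> : i = ((2 * i./2) + odd i)%N by rewrite mul2n addnC odd_double_half.
case: (odd i); rewrite ?addn1 ?addn0.
  rewrite coef_omega_odd big1 // => k _.
  by rewrite !mul2n; case: eqP => [/(congr1 odd)|];
    rewrite ?mulr0 //= !odd_double.
rewrite coef_omega_even; move: i./2 => m.
have [mn|nm] := leqP m n; last first.
  rewrite /lidstone_mx leqNgt nm /= big1 // => k _.
  rewrite eqn_pmul2l // gtn_eqF ?mulr0 //; exact: leq_trans (ltn_ord k) _.
rewrite (bigD1 (Ordinal (mn : (m < n.+1)%N))) //= eqxx mulr1 big1 ?addr0 //.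
move=> k; rewrite -(inj_eq val_inj) /= eqn_pmul2l // eq_sym => /negPf ->.
by rewrite mulr0.
Qed.

End EvenLidstone.

Theorem theorem3p15 (R : realType) (q : R) (hq0 : 0 < q) (hq1 : q < 1)
    (omega : nat -> {poly R}) (homega : is_qELS1 q omega)
    (xi : nat -> R) (hxi : is_xi_seq q omega xi)
    (G : nat -> nat -> R) (hG : is_inverse (lidstone_mx q omega) G)
    (P : nat -> nat -> R) (hP : is_production_matrix G P) :
  omega 0%N = (1 / xi 0%N)%:P /\
  forall n : nat,
    omega n.+1 =
      (1 / P n n.+1) *: ('X^2 * omega n - \sum_(k < n.+1) P n k *: omega k).
Proof.
set F := lidstone_mx q omega in hG; have [lF lG FG GF] := hG.
split.
  (* The case [n = 0] of [hxi] reads [g * xi 0 = 1]. *)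
  have [_ _ [g g0 o0]] := homega; rewrite o0; congr _%:P.
  have := hxi 0%N; rewrite big_ord1 /= qfact0 mulr1 divr1 subnn.
  rewrite /gammaE o0 hornerC => gx.
  have x0 : xi 0%N != 0.
    by apply: contra_eq_neq gx => ->; rewrite mulr0 eq_sym oner_neq0.
  by apply: (mulIf x0); rewrite gx divfK.
have [N hN PE] := hP.
(* [hP] supplies its own inverse of [G]; uniqueness identifies it with [F]. *)
have NF : F =2 N by exact: is_inverse_uniq hG hN.
have PFG i j : P i j = lmul F (drop_first_row G) i j.
  by rewrite PE; apply: eq_bigr => k _; rewrite NF.
pose e k : {poly R} := 'X^(2 * k).
have omF n : omega n = lact F e n by exact: omegaE.
(* [e = (GF)e = G(Fe) = G omega]. *)
have eG k : e k = lact G omega k.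
  rewrite -[LHS](lact1 e k) -(eq_lact (GF k) (frefl e)) // lactM //.
  exact: eq_lact.
move=> n.
have zomega : 'X^2 * omega n = \sum_(j < n.+2) P n j *: omega j.
  under eq_bigr do rewrite PFG.
  rewrite -lact_drop_first_row // omF mulr_sumr; apply: eq_bigr => k _.
  by rewrite -scalerAr -exprD -mulnS -/(e k.+1) eG.
(* This entry is [F n n * G n.+1 n.+1], and neither factor vanishes because [F m m * G m m = 1] for
   every [m]. *)
have P0 : P n n.+1 != 0.
  rewrite PFG lmul_drop_first_row_diag //.
  have d0 m : F m m * G m m != 0 by rewrite is_inverse_diag ?oner_neq0.
  have := d0 n; have := d0 n.+1; rewrite !mulf_eq0 !negb_or.
  by move=> /andP[_ ->] /andP[-> _].
rewrite zomega big_ord_recr /= addrC addrK scalerA mul1r mulVf //.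
by rewrite scale1r.
Qed.
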